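(* Let $G$ be an abelian group and let $A, B \subset G$ be finite subsets such that $|A+B| \le |A|+|B|-2$. Then $A+B$ is periodic.
   Context: For subsets $A,B$ of an abelian group $G$ (written additively), $A+B=\{x+y : x\in A,\ y\in B\}$ is the Minkowski sum. A subset $X\subset G$ is periodic if there is a non-zero subgroup $N$ of $G$ with $X+N=X$. *)

(* Defs.v *)
From mathcomp Require Import all_boot all_algebra.
From mathcomp Require Import boolp classical_sets functions cardinality.

Set Implicit Arguments.
Unset Strict Implicit.
Unset Printing Implicit Defensive.

Import GRing.Theory.
Local Open Scope classical_set_scope.
Local Open Scope ring_scope.

Definition sumset (G : zmodType) (A B : set G) : set G :=
  [set x + y | x in A & y in B].

(* [N] ranges over all subgroups of [G], infinite ones included: this matters
   for [X = set0], which is periodic exactly when [G] is not the zero group. *)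
Definition periodic (G : zmodType) (X : set G) : Prop :=
  exists N : zmodClosed G,
    (exists2 x : G, x \in N & x != 0) /\ sumset X [set` N] = X.

(* Main.v *)
Require Import Defs.
From mathcomp Require Import all_boot all_algebra finmap.
From mathcomp Require Import boolp classical_sets functions cardinality.
From mathcomp Require Import zify.
From HB Require Import structures.

Set Implicit Arguments.
Unset Strict Implicit.
Unset Printing Implicit Defensive.

Import GRing.Theory.
Local Open Scope classical_set_scope.
Local Open Scope fset_scope.
Local Open Scope ring_scope.

(** The theorem is a weak form of Kneser's theorem, which is proved here after
    DeVos, inside the finite subsets of [G] and without quotient groups: for
    nonempty finite [A], [B] there is a finite subgroup [H] with
    [A + B + H = A + B] and [|A| + |B| <= |A + B| + |H|] ([kneser]). If
    moreover [|A + B| <= |A| + |B| - 2], then [|H| >= 2], so [H] witnesses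
    periodicity. When [A] or [B] is empty the sum is empty, hence invariant
    under all of [G], and [G] is nonzero because the other set has two elements.

    The proof is by induction on [|A + B|], then on [|A|]. If [A] lies in every
    translate of [B] that it meets, then the stabilizer of [B] contains a
    translate of [A] and serves as [H] ([kneser_bound_translates]). Otherwise
    [B] can be translated so that [A] meets [B] without being contained in it.
    Then [(A & B) + (A | B)] is contained in [A + B], while [|A & B| < |A|] and
    [|A & B| + |A | B| = |A| + |B|]. If these two sets are equal, the bound for
    the pair [A & B], [A | B] is the bound for [A], [B]. If not, the inductive
    hypothesis shows that [(A & B) + (A | B)] with one of its periods [K] is a
    convergent: a nonempty [C] inside [A + B], with period [K], such that
    [|A & B| + |(A | B) + K| <= |C| + |K|].

    Among all convergents take one with [|K|] minimal ([convergent_bound]). If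
    [K] is a period of [A + B], it satisfies the required bound. If not, some
    coset [a + b + K] with [a] in [A] and [b] in [B] is not covered by [A + B],
    so it is disjoint from [C]. Put [A1 = A & (a + K)], [B1 = B & (b + K)] and
    let [H1] be a period of [A1 + B1] given by induction. It is a proper
    subgroup of [K], so by minimality [C | (A1 + B1)] with [H1] is not a
    convergent. Comparing this failure with the convergence of [C]
    ([coset_pair_bounds]) shows first that the exchanged pair
    [A2 = A & (b + K)], [B2 = B & (a + K)] also consists of nonempty sets, and
    that the two cosets are distinct. Let [H2] be the period of [A2 + B2]. If
    the bound fails for [A], [B], counting the holes of [A | B] in both cosets
    gives [|K| < |A1| + |B1| + |H2|] and [|K| < |A2| + |B2| + |H1|], whereas
    divisibility by [|Hi|] gives [|Ai| + |Bi| + |Hi| <= |K|]. Thus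
    [|H1| < |H2| < |H1|], which is absurd. *)

(** [lia] restricted to the hypotheses on cardinals. Its preprocessing inspects
    every boolean hypothesis, and the equalities and inclusions of finite sets
    present in the proofs below make it intractable. *)
Ltac card_lia :=
  intros;
  repeat match goal with
  | H : ?T |- _ =>
      lazymatch T with
      | is_true (leq _ _) => fail
      | @eq nat _ _ => fail
      | _ => clear H
      end
  end; lia.

(** * Sums of finite sets *)

Definition fsum (G : zmodType) (A B : {fset G}) : {fset G} :=
  [fset x + y | x in A, y in B].

Local Notation "A <+> B" := (fsum A B) (at level 50, left associativity).

Lemma fsumP (G : zmodType) (A B : {fset G}) (z : G) :
  reflect (exists2 x, x \in A & exists2 y, y \in B & z = x + y)
          (z \in A <+> B).
Proof.
apply: (iffP (imfset2P _ _ _ _ _)) => -[x /= xA [y /= yB ->]];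
  by exists x => //; exists y.
Qed.

Lemma mem_fsum (G : zmodType) (A B : {fset G}) (x y : G) :
  x \in A -> y \in B -> x + y \in A <+> B.
Proof. by move=> xA yB; apply/fsumP; exists x => //; exists y. Qed.

Lemma fsumS (G : zmodType) (A A' B B' : {fset G}) :
  A `<=` A' -> B `<=` B' -> A <+> B `<=` A' <+> B'.
Proof.
move=> /fsubsetP sA /fsubsetP sB; apply/fsubsetP => z /fsumP[x xA [y yB ->]].
by rewrite mem_fsum ?sA ?sB.
Qed.

Lemma fsumC (G : zmodType) (A B : {fset G}) : A <+> B = B <+> A.
Proof.
by apply/fsetP => z; apply/fsumP/fsumP => -[x xA [y yB ->]];
  exists y => //; exists x; rewrite // addrC.
Qed.

Lemma fsumA (G : zmodType) (A B C : {fset G}) :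
  A <+> (B <+> C) = A <+> B <+> C.
Proof.
apply/fsetP => z; apply/fsumP/fsumP.
  move=> [x xA [_ /fsumP[y yB [t tC ->]] ->]].
  by exists (x + y); [exact: mem_fsum | exists t; rewrite // addrA].
move=> [_ /fsumP[x xA [y yB ->]] [t tC ->]].
by exists x => //; exists (y + t); [exact: mem_fsum | rewrite addrA].
Qed.

Lemma fsum1 (G : zmodType) (x y : G) : [fset x] <+> [fset y] = [fset x + y].
Proof.
apply/fsetP => z; rewrite inE; apply/fsumP/eqP.
  by move=> [_ /fset1P-> [_ /fset1P->]].
by move=> ->; exists x; rewrite ?inE //; exists y; rewrite ?inE.
Qed.

Lemma fsumUl (G : zmodType) (A B C : {fset G}) :
  (A `|` B) <+> C = (A <+> C) `|` (B <+> C).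
Proof.
apply/fsetP => z; rewrite inE; apply/fsumP/orP.
  move=> [x + [y yC ->]].
  by rewrite inE => /orP[]xA; [left|right]; exact: mem_fsum.
by case=> /fsumP[x xA [y yC ->]]; exists x;
  rewrite ?inE ?xA ?orbT //; exists y.
Qed.

Lemma fsum_neq0 (G : zmodType) (A B : {fset G}) :
  A != fset0 -> B != fset0 -> A <+> B != fset0.
Proof.
move=> /fset0Pn[x xA] /fset0Pn[y yB].
by apply/fset0Pn; exists (x + y); exact: mem_fsum.
Qed.

(** * Finite subgroups and their cosets *)

Definition coset (G : zmodType) (x : G) (K : {fset G}) := [fset x] <+> K.

Definition subgroup (G : zmodType) (K : {fset G}) : Prop :=
  0 \in K /\ {in K &, forall x y, x - y \in K}.

Lemma mem_coset (G : zmodType) (x y : G) (K : {fset G}) :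
  (y \in coset x K) = (y - x \in K).
Proof.
apply/fsumP/idP => [[_ /fset1P-> [k kK ->]]|yxK]; first by rewrite addrC addKr.
by exists x; rewrite ?inE //; exists (y - x); rewrite // addrC subrK.
Qed.

Lemma card_coset (G : zmodType) (x : G) (K : {fset G}) :
  #|` coset x K| = #|` K|.
Proof.
have -> : coset x K = [fset x + k | k in K].
  apply/fsetP => y; rewrite mem_coset; apply/idP/imfsetP => /=.
    by move=> yK; exists (y - x); rewrite // addrC subrK.
  by move=> [k kK ->]; rewrite addrC addKr.
by rewrite card_imfset //; exact: addrI.
Qed.

Lemma fsum0l (G : zmodType) (C : {fset G}) : [fset 0] <+> C = C.
Proof. by apply/fsetP => z; rewrite mem_coset subr0. Qed.

Lemma cosetD (G : zmodType) (x y : G) (K : {fset G}) :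
  coset (x + y) K = [fset x] <+> coset y K.
Proof. by rewrite /coset fsumA fsum1. Qed.

Lemma subgroup0 (G : zmodType) (K : {fset G}) : subgroup K -> 0 \in K.
Proof. by case. Qed.

Lemma subgroupB (G : zmodType) (K : {fset G}) (x y : G) :
  subgroup K -> x \in K -> y \in K -> x - y \in K.
Proof. by move=> [_ +]; exact. Qed.

Lemma subgroupN (G : zmodType) (K : {fset G}) (x : G) :
  subgroup K -> x \in K -> - x \in K.
Proof. by move=> sK xK; rewrite -sub0r subgroupB ?subgroup0. Qed.

Lemma subgroupD (G : zmodType) (K : {fset G}) (x y : G) :
  subgroup K -> x \in K -> y \in K -> x + y \in K.
Proof.
by move=> sK xK yK; rewrite -[y]opprK subgroupB ?subgroupN.
Qed.

Lemma subgroup_neq0 (G : zmodType) (K : {fset G}) : subgroup K -> K != fset0.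
Proof. by move=> sK; apply/fset0Pn; exists 0; exact: subgroup0. Qed.

Lemma subgroup_idem (G : zmodType) (K : {fset G}) : subgroup K -> K <+> K = K.
Proof.
move=> sK; apply/fsetP => z; apply/fsumP/idP => [[x xK [y yK ->]]|zK].
  exact: subgroupD.
by exists z => //; exists 0; rewrite ?addr0 ?subgroup0.
Qed.

Lemma sub_fsum (G : zmodType) (A K : {fset G}) : subgroup K -> A `<=` A <+> K.
Proof.
move=> sK; apply/fsubsetP => x xA; rewrite -[x]addr0.
by rewrite mem_fsum ?subgroup0.
Qed.

Lemma fsum_subgroupK (G : zmodType) (A K : {fset G}) :
  subgroup K -> A <+> K <+> K = A <+> K.
Proof. by move=> sK; rewrite -fsumA subgroup_idem. Qed.

Lemma mem_coset_id (G : zmodType) (x : G) (K : {fset G}) :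
  subgroup K -> x \in coset x K.
Proof. by move=> sK; rewrite mem_coset subrr subgroup0. Qed.

Lemma coset_eq (G : zmodType) (x y : G) (K : {fset G}) :
  subgroup K -> y \in coset x K -> coset y K = coset x K.
Proof.
move=> sK; rewrite mem_coset => yxK; apply/fsetP => z; rewrite !mem_coset.
apply/idP/idP => h.
  by rewrite -[z](subrK y) -addrA subgroupD.
by rewrite -[z](subrK x) -addrA subgroupD // -opprB subgroupN.
Qed.

Lemma coset_sub (G : zmodType) (x : G) (X K : {fset G}) :
  X <+> K = X -> x \in X -> coset x K `<=` X.
Proof.
by move=> XK xX; rewrite -XK; apply: fsumS; rewrite ?fsub1set.
Qed.

Lemma coset_disjoint (G : zmodType) (x : G) (X K : {fset G}) :
  subgroup K -> X <+> K = X -> x \notin X -> [disjoint X & coset x K]%fset.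
Proof.
move=> sK XK xX; apply/fdisjointP => y yX; apply: contra xX => yx.
by apply: (fsubsetP (coset_sub XK yX)); rewrite (coset_eq sK yx) mem_coset_id.
Qed.

(** A set with period [H] is a disjoint union of cosets of [H]; they are removed
    one at a time. *)
Lemma dvdn_card_periodic (G : zmodType) (H X : {fset G}) :
  subgroup H -> X <+> H = X -> (#|` H| %| #|` X|)%N.
Proof.
move=> sH; have [n] := ubnP #|` X|; elim: n X => // n IHn X ltXn XH.
have [->|/fset0Pn[x xX]] := eqVneq X fset0; first by rewrite cardfs0 dvdn0.
have sxX := coset_sub XH xX.
have cX : (#|` X `\` coset x H| + #|` H| = #|` X|)%N.
  by rewrite -(card_coset x H) cardfsDS // subnK // fsubset_leq_card.
have H0 : (0 < #|` H|)%N by rewrite cardfs_gt0 subgroup_neq0.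
rewrite -cX dvdn_addl // IHn //; first by lia.
apply/eqP; rewrite eqEfsubset sub_fsum // andbT.
apply/fsubsetP => _ /fsumP[y /fsetDP[yX yx] [h hH ->]].
rewrite inE -XH (mem_fsum yX hH) andbT.
apply: contra yx; rewrite !mem_coset => yhx.
have -> : y - x = y + h - x - h by rewrite [y + h - x]addrAC addrK.
exact: subgroupB.
Qed.

(** Counts holes: [U + K] contains the whole coset [x + K], so the elements of
    [x + K] outside [U'] come on top of [U']. *)
Lemma leq_card_fsum_coset (G : zmodType) (K U U' : {fset G}) (x : G) :
  subgroup K -> U' `<=` U <+> K -> x \in U <+> K ->
  (#|` U'| + #|` K| <= #|` U <+> K| + #|` U' `&` coset x K|)%N.
Proof.
move=> sK sU' xU; rewrite -(card_coset x K) -cardfsUI leq_add2r.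
apply: fsubset_leq_card; rewrite fsubUset sU' coset_sub //.
exact: fsum_subgroupK.
Qed.

Lemma fsumI_coset (G : zmodType) (U K H : {fset G}) (x : G) :
  subgroup K -> H `<=` K ->
  (U <+> H) `&` coset x K = (U `&` coset x K) <+> H.
Proof.
move=> sK /fsubsetP sHK; apply/fsetP => z; rewrite inE mem_coset.
apply/andP/fsumP => [[/fsumP[u uU [h hH ->]] uhx]|[u + [h hH ->]]].
  exists u; last by exists h.
  have eu : u - x = u + h - x - h by rewrite [u + h - x]addrAC addrK.
  by rewrite inE uU mem_coset eu; apply: subgroupB (sHK _ hH).
rewrite inE mem_coset => /andP[uU ux]; split; first exact: mem_fsum.
by rewrite addrAC; apply: subgroupD (sHK _ hH).
Qed.

(** * Stabilizers *)

(** Every [g] with [g + C = C] is a difference of two elements of [C] when [C]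
    is nonempty; the separation over [C - C] only makes the stabilizer a finite
    set by construction. *)
Definition stab (G : zmodType) (C : {fset G}) : {fset G} :=
  [fset g in C <+> [fset - x | x in C] | [fset g] <+> C == C].

Lemma mem_stab (G : zmodType) (C : {fset G}) (g : G) :
  C != fset0 -> (g \in stab C) = ([fset g] <+> C == C).
Proof.
move=> /fset0Pn[c cC]; rewrite !inE /=; apply/andb_idl => /eqP gC.
apply/fsumP; exists (g + c); first by rewrite -gC mem_fsum ?inE.
by exists (- c); rewrite ?addrK //; apply/imfsetP; exists c.
Qed.

Lemma stab_subgroup (G : zmodType) (C : {fset G}) :
  C != fset0 -> subgroup (stab C).
Proof.
move=> C0; split => [|x y]; rewrite !mem_stab // ?fsum0l //.
move=> /eqP xC /eqP yC; rewrite -[in X in _ <+> X]yC fsumA fsum1.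
by rewrite subrK xC.
Qed.

Lemma fsum_stab (G : zmodType) (C : {fset G}) :
  C != fset0 -> C <+> stab C = C.
Proof.
move=> C0; apply/eqP; rewrite eqEfsubset sub_fsum ?andbT; last first.
  exact: stab_subgroup.
apply/fsubsetP => _ /fsumP[x xC [g + ->]].
by rewrite mem_stab // addrC => /eqP <-; rewrite mem_fsum ?inE.
Qed.

Lemma sub_stab (G : zmodType) (C H : {fset G}) :
  C != fset0 -> subgroup H -> C <+> H = C -> H `<=` stab C.
Proof.
move=> C0 sH CH; apply/fsubsetP => h hH; rewrite mem_stab // eqEfcard.
rewrite card_coset leqnn andbT -{2}CH fsumC.
by apply: fsumS; rewrite ?fsub1set.
Qed.

(** * Kneser's bound *)

(** [H] is any period of [A + B]. Enlarging [H] to the stabilizer keeps the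
    inequality, so this is the usual form of the bound with the stabilizer
    in place of [H]. *)
Definition kneser_bound (G : zmodType) (A B : {fset G}) : Prop :=
  exists H : {fset G}, [/\ subgroup H, A <+> B <+> H = A <+> B &
    (#|` A| + #|` B| <= #|` A <+> B| + #|` H|)%N].

Definition strong_kneser_bound (G : zmodType) (A B : {fset G}) : Prop :=
  exists H : {fset G}, [/\ subgroup H, A <+> B <+> H = A <+> B &
    (#|` A <+> H| + #|` B <+> H| <= #|` A <+> B| + #|` H|)%N].

(** Applying the plain bound to [A + S] and [B + S], where [S] is the stabilizer
    of [A + B], leaves the sum unchanged, and the period [H] it provides is
    contained in [S]. Hence only pairs with the very same sum are needed. *)
Lemma kneser_bound_strong (G : zmodType) (A B : {fset G}) :
  A != fset0 -> B != fset0 ->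
  (forall A' B' : {fset G}, A' != fset0 -> B' != fset0 ->
     A' <+> B' = A <+> B -> kneser_bound A' B') ->
  strong_kneser_bound A B.
Proof.
move=> A0 B0 bound; have AB0 := fsum_neq0 A0 B0.
set S := stab (A <+> B); have sS : subgroup S := stab_subgroup AB0.
have S0 := subgroup_neq0 sS.
have AS_BS : A <+> S <+> (B <+> S) = A <+> B.
  rewrite -fsumA (fsumC S) -fsumA subgroup_idem // fsumA.
  exact: fsum_stab.
have [||H [sH pH leH]] := bound (A <+> S) (B <+> S) _ _ AS_BS.
- exact: fsum_neq0.
- exact: fsum_neq0.
rewrite AS_BS in pH leH; exists H; split => //.
have sHS : H `<=` S by exact: sub_stab.
by apply: leq_trans leH; apply: leq_add; apply/fsubset_leq_card/fsumS.
Qed.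

(** * Convergents *)

Definition convergent (G : zmodType) (A B C K : {fset G}) : Prop :=
  [/\ subgroup K, C <+> K = C, C != fset0, C `<=` A <+> B &
    (#|` A `&` B| + #|` (A `|` B) <+> K| <= #|` C| + #|` K|)%N].

(** The local analysis at a coset [a + b + K] that [A + B] does not cover.
    [A1 + B1] lies in that coset, hence is disjoint from [C] and smaller than
    [A + B], and the inductive hypothesis gives it a period [H], necessarily a
    proper subgroup of [K]. The first two bounds express that the minimality of
    [K] prevents [C | (A1 + B1)] from being a convergent with period [H], the
    first one being sharpened by divisibility by [|H|]. The last one
    comes from the fact that [C] and [A1 + B1] are disjoint parts of [A + B]. *)
Lemma coset_pair_bounds (G : zmodType) (A B C K : {fset G}) (a b : G) :
  (forall A' B' : {fset G}, A' != fset0 -> B' != fset0 ->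
     (#|` A' <+> B'| < #|` A <+> B|)%N -> strong_kneser_bound A' B') ->
  convergent A B C K ->
  (forall C' K' : {fset G}, convergent A B C' K' -> (#|` K| <= #|` K'|)%N) ->
  a \in A -> b \in B -> ~~ (coset (a + b) K `<=` A <+> B) ->
  let A1 := A `&` coset a K in let B1 := B `&` coset b K in
  exists H : {fset G}, [/\ subgroup H, H `<=` K,
    (#|` A1| + #|` B1| + #|` H| <= #|` K|)%N,
    (#|` A1 <+> H| + #|` B1 <+> H| + #|` (A `|` B) <+> K|
       < #|` (A `|` B) <+> H| + #|` K|)%N &
    (#|` A1| + #|` B1| + #|` A `&` B| + #|` (A `|` B) <+> K|
       <= #|` A <+> B| + #|` K| + #|` H|)%N].
Proof.
move=> IH [sK CK C0 CAB cvg] minK aA bB abK A1 B1.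
have aA1 : a \in A1 by rewrite inE aA mem_coset_id.
have bB1 : b \in B1 by rewrite inE bB mem_coset_id.
have sub11 : A1 <+> B1 `<=` A <+> B by apply: fsumS; exact: fsubsetIl.
have sub11K : A1 <+> B1 `<=` coset (a + b) K.
  rewrite cosetD /coset [_ <+> K]fsumC fsumA -(subgroup_idem sK) fsumA -fsumA.
  by apply: fsumS; rewrite ?[K <+> _]fsumC; exact: fsubsetIr.
have A10 : A1 != fset0 by apply/fset0Pn; exists a.
have B10 : B1 != fset0 by apply/fset0Pn; exists b.
have abC : a + b \notin C.
  apply: contra abK => abC; exact: fsubset_trans (coset_sub CK abC) CAB.
have dis : [disjoint C & A1 <+> B1]%fset.
  exact: fdisjointWr sub11K (coset_disjoint sK CK abC).
have cardU : #|` C `|` (A1 <+> B1)| = (#|` C| + #|` A1 <+> B1|)%N.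
  by rewrite -cardfsUI (eqP dis) cardfs0 addn0.
have subU : C `|` (A1 <+> B1) `<=` A <+> B by rewrite fsubUset CAB.
have leU : (#|` C| + #|` A1 <+> B1| <= #|` A <+> B|)%N.
  by rewrite -cardU fsubset_leq_card.
have posC : (0 < #|` C|)%N by rewrite cardfs_gt0.
have [|H [sH pH leH]] := IH A1 B1 A10 B10; first by card_lia.
have sHK : H `<=` K.
  apply/fsubsetP => h hH.
  have : a + b + h \in coset (a + b) K.
    by apply: (fsubsetP sub11K); rewrite -pH !mem_fsum.
  by rewrite mem_coset addrC addKr.
have CH : C <+> H = C.
  by apply/eqP; rewrite eqEfsubset sub_fsum // andbT -{2}CK fsumS.
have HK : H != K.
  apply: contra abK => /eqP HK; rewrite -HK; apply: fsubset_trans sub11.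
  exact: coset_sub pH (mem_fsum aA1 bB1).
have ltHK : (#|` H| < #|` K|)%N.
  by rewrite fproper_ltn_card // fproperEneq HK.
have ncvg : (#|` C| + #|` A1 <+> B1| + #|` H|
             < #|` A `&` B| + #|` (A `|` B) <+> H|)%N.
  rewrite ltnNge; apply/negP => le; suff : (#|` K| <= #|` H|)%N by card_lia.
  apply: (minK (C `|` (A1 <+> B1))); split; rewrite ?cardU //.
    by rewrite fsumUl CH pH.
  by apply: contra C0 => /eqP; rewrite -fsubset0 => <-; exact: fsubsetUl.
have leUK : (#|` (A `|` B) <+> H| <= #|` (A `|` B) <+> K|)%N.
  by apply/fsubset_leq_card/fsumS.
have leA1 := fsubset_leq_card (sub_fsum A1 sH).
have leB1 := fsubset_leq_card (sub_fsum B1 sH).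
exists H; split => //; [|by card_lia..].
have lt1 : (#|` A1 <+> H| + #|` B1 <+> H| < #|` K|)%N by card_lia.
have KH : K <+> H = K.
  apply/eqP; rewrite eqEfsubset sub_fsum // andbT.
  by rewrite -{2}(subgroup_idem sK) fsumS.
(* All three terms of [lt1] are multiples of [|H|], so the gap is at least
   [|H|]. *)
have dA := dvdn_card_periodic sH (fsum_subgroupK A1 sH).
have dB := dvdn_card_periodic sH (fsum_subgroupK B1 sH).
have dK := dvdn_card_periodic sH KH.
have dd : (#|` H| %| #|` K| - (#|` A1 <+> H| + #|` B1 <+> H|))%N.
  by rewrite dvdn_sub // dvdn_add.
by have := dvdn_leq _ dd; rewrite subn_gt0 => /(_ lt1); card_lia.
Qed.

(** If [K] is a period of [A + B] for some convergent [C], [K], the bound holds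
    with [K], because [|C| <= |A + B|] and [|A & B| + |A | B| = |A| + |B|].
    Choosing [|K|] minimal rules out the other case: the two pairs of pieces of
    [A] and [B] in the cosets [a + K] and [b + K] would have periods [H1] and
    [H2] with [|H1| < |H2| < |H1|]. *)
Lemma convergent_bound (G : zmodType) (A B : {fset G}) :
  (forall A' B' : {fset G}, A' != fset0 -> B' != fset0 ->
     (#|` A' <+> B'| < #|` A <+> B|)%N -> strong_kneser_bound A' B') ->
  (exists C K, convergent A B C K) -> kneser_bound A B.
Proof.
move=> IH [C0 [K0 cvg0]].
have [C [K [cvg minK]]] : exists C K, convergent A B C K /\
    forall C' K', convergent A B C' K' -> (#|` K| <= #|` K'|)%N.
  have [n] := ubnP #|` K0|; elim: n C0 K0 cvg0 => // n IHn C K cvg ltKn.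
  have [[C' [K' [cvg' lt]]]|nex] := pselect (exists C' K',
      convergent A B C' K' /\ (#|` K'| < #|` K|)%N).
    by apply: (IHn C' K') => //; card_lia.
  exists C, K; split => // C' K' cvg'; rewrite leqNgt; apply/negP => lt.
  by apply: nex; exists C', K'.
have [sK CK _ CAB leC] := cvg.
apply: contrapT => nbound.
have lt_n H : subgroup H -> A <+> B <+> H = A <+> B ->
    (#|` A <+> B| + #|` H| < #|` A| + #|` B|)%N.
  by move=> sH pH; rewrite ltnNge; apply/negP => le; apply: nbound; exists H.
have cUI := cardfsUI A B.
have leUK := fsubset_leq_card (sub_fsum (A `|` B) sK).
have leCAB := fsubset_leq_card CAB.
(* The trivial subgroup is always a period. *)
have ltAB : (#|` A <+> B| < #|` A| + #|` B|)%N.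
  have s0 : subgroup [fset (0 : G)].
    by split => [|x y]; rewrite !inE // => /eqP-> /eqP->; rewrite subrr.
  by have := lt_n _ s0 (etrans (fsumC _ _) (fsum0l _)); card_lia.
have /fsubsetPn[_ /fsumP[_ /fsumP[a aA [b bB ->]] [k kK ->]] abk] :
    ~~ (A <+> B <+> K `<=` A <+> B).
  apply/negP => sub; suff /(lt_n _ sK) : A <+> B <+> K = A <+> B by card_lia.
  by apply/eqP; rewrite eqEfsubset sub sub_fsum.
have abK : ~~ (coset (a + b) K `<=` A <+> B).
  by apply/fsubsetPn; exists (a + b + k); rewrite // mem_coset addrC addKr.
set U := A `|` B in cUI leC leUK *.
have sUK := sub_fsum U sK.
have aU : a \in U by rewrite inE aA.
have bU : b \in U by rewrite inE bB orbT.
have aUK := fsubsetP sUK _ aU; have bUK := fsubsetP sUK _ bU.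
have [H1 [sH1 H1K small1 big1 tot1]] :=
  coset_pair_bounds IH cvg minK aA bB abK.
rewrite -/U in big1 tot1.
have UH1 : U <+> H1 `<=` U <+> K by exact: fsumS.
have Pa := leq_card_fsum_coset sK UH1 aUK.
have Qb := leq_card_fsum_coset sK UH1 bUK.
rewrite !fsumI_coset // in Pa Qb.
have UI x : U `&` coset x K = (A `&` coset x K) `|` (B `&` coset x K).
  exact: fsetIUl.
(* [Pa] and [big1] say that [|A1 + H1| + |B1 + H1|] is smaller than the
   cardinal of [(U & (a + K)) + H1]. This fails if [B] misses [a + K], where
   [U & (a + K)] is just [A1], and also if [b] is in [a + K], where it is
   [A1 | B1]. Symmetrically, [Qb] forces [A] to meet [b + K]. *)
have [b2 b2B] : exists b2, b2 \in B `&` coset a K.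
  apply/fset0Pn/negP => /eqP B20; move: Pa.
  by rewrite UI B20 fsetU0; card_lia.
have [a2 a2A] : exists a2, a2 \in A `&` coset b K.
  apply/fset0Pn/negP => /eqP A20; move: Qb.
  by rewrite UI A20 fset0U; card_lia.
have abN : b \notin coset a K.
  apply/negP => /(coset_eq sK) eqK; move: Pa big1.
  rewrite eqK UI fsumUl => Pa big1.
  have := cardfsUI ((A `&` coset a K) <+> H1) ((B `&` coset a K) <+> H1).
  by card_lia.
move: a2A b2B; rewrite !in_fsetI => /andP[a2A a2b] /andP[b2B b2a].
have eqb := coset_eq sK a2b; have eqa := coset_eq sK b2a.
(* The exchanged pair sums into the same uncovered coset, so the local bounds
   apply to it as well. *)
have abK2 : ~~ (coset (a2 + b2) K `<=` A <+> B).
  by rewrite cosetD eqa -cosetD addrC cosetD eqb -cosetD.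
have [H2 [_ _ small2 _ tot2]] := coset_pair_bounds IH cvg minK a2A b2B abK2.
rewrite -/U eqa eqb in small2 tot2.
(* The two cosets are disjoint, so their holes can be counted one after the
   other. *)
have holes : (#|` U| + #|` K| + #|` K|
    <= #|` U <+> K| + #|` U `&` coset a K| + #|` U `&` coset b K|)%N.
  have aKU : coset a K `<=` U <+> K.
    exact: coset_sub (fsum_subgroupK U sK) aUK.
  have dis : coset a K `&` coset b K = fset0.
    by apply/eqP; apply: coset_disjoint => //; exact: fsum_subgroupK.
  have : (#|` (U `|` coset a K)| + #|` K|
         <= #|` U <+> K| + #|` (U `|` coset a K) `&` coset b K|)%N.
    by apply: leq_card_fsum_coset; rewrite // fsubUset sUK.
  rewrite fsetIUl dis fsetU0.
  by have := cardfsUI U (coset a K); rewrite card_coset; card_lia.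
(* [tot1] and [tot2] with [holes] and [ltAB] give [|K| < |A2| + |B2| + |H1|] and
   [|K| < |A1| + |B1| + |H2|]; [small1] and [small2] then give both
   [|H2| < |H1|] and [|H1| < |H2|]. *)
have PU := cardfsUI (A `&` coset a K) (B `&` coset a K).
have QU := cardfsUI (A `&` coset b K) (B `&` coset b K).
rewrite -!UI in PU QU.
card_lia.
Qed.

(** * Kneser's theorem *)

Lemma kneser_bound_shift (G : zmodType) (A B : {fset G}) (g : G) :
  kneser_bound A ([fset g] <+> B) -> kneser_bound A B.
Proof.
have shiftE : A <+> ([fset g] <+> B) = coset g (A <+> B).
  by rewrite /coset fsumA (fsumC A) -fsumA.
move=> [H [sH]]; rewrite shiftE !card_coset => pH leH; exists H; split => //.
apply/eqP; rewrite eq_sym eqEfcard sub_fsum //= -(card_coset g (A <+> B)) -pH.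
by rewrite -(card_coset g (A <+> B <+> H)) /coset fsumA.
Qed.

(** If [a] and [a0] are in [A] and [b] in [B], then [a] belongs to
    [a0 - b + B], that is, [a - a0 + b] belongs to [B]. So [A - a0] is contained
    in the stabilizer of [B]. *)
Lemma kneser_bound_translates (G : zmodType) (A B : {fset G}) :
  A != fset0 -> B != fset0 ->
  (forall a b, a \in A -> b \in B -> A `<=` coset (a - b) B) ->
  kneser_bound A B.
Proof.
move=> /fset0Pn[a0 a0A] B0 sub.
have sS := stab_subgroup B0; exists (stab B); split => //.
  by rewrite -fsumA fsum_stab.
have leA : (#|` A| <= #|` stab B|)%N.
  rewrite -(card_coset a0 (stab B)); apply/fsubset_leq_card/fsubsetP => a aA.
  rewrite mem_coset mem_stab // eqEfcard card_coset leqnn andbT.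
  apply/fsubsetP => _ /fsumP[_ /fset1P-> [b bB ->]].
  have := fsubsetP (sub a0 b a0A bB) a aA.
  by rewrite mem_coset opprB addrCA addrC.
have leB : (#|` B| <= #|` A <+> B|)%N.
  rewrite -(card_coset a0 B); apply: fsubset_leq_card.
  by apply: fsumS; rewrite ?fsub1set.
card_lia.
Qed.

(** Replaces the pair [A], [B] by [A & B], [A | B], after a translation making
    [A & B] nonempty and smaller than [A]. Since the strong bound for a given
    pair needs the plain one for larger sets with the same sum, it is available
    only when [|A + B|] drops; when it does not, the plain bound, obtained from
    the inner induction on [|A|], is enough. *)
Lemma kneser (G : zmodType) (A B : {fset G}) :
  A != fset0 -> B != fset0 -> kneser_bound A B.
Proof.
have [n] := ubnP #|` A <+> B|; elim: n A B => // n IHn A B + A0 B0.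
rewrite ltnS => leABn.
have strong (A' B' : {fset G}) : A' != fset0 -> B' != fset0 ->
    (#|` A' <+> B'| < n)%N -> strong_kneser_bound A' B'.
  move=> A'0 B'0 lt; apply: kneser_bound_strong => // X Y X0 Y0 eqXY.
  by apply: IHn; rewrite ?eqXY.
have [m] := ubnP #|` A|; elim: m A B leABn A0 B0 => // m IHm A B leABn A0 B0.
rewrite ltnS => leAm.
have [[a [b [aA bB nsub]]]|nex] := pselect (exists a b,
    [/\ a \in A, b \in B & ~~ (A `<=` coset (a - b) B)]); last first.
  apply: kneser_bound_translates => // a b aA bB; apply: contrapT => /negP nsub.
  by apply: nex; exists a, b.
apply: (kneser_bound_shift (g := a - b)).
rewrite -/(coset (a - b) B); set B' := coset (a - b) B in nsub *.
have aB' : a \in B' by rewrite mem_coset subKr.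
have leAB' : (#|` A <+> B'| <= n)%N.
  by rewrite /B' /coset fsumA (fsumC A) -fsumA card_coset.
have B'0 : B' != fset0 by apply/fset0Pn; exists a.
have I0 : A `&` B' != fset0 by apply/fset0Pn; exists a; rewrite inE aA.
have U0 : A `|` B' != fset0 by apply/fset0Pn; exists a; rewrite inE aA.
have sIU : (A `&` B') <+> (A `|` B') `<=` A <+> B'.
  apply/fsubsetP => _ /fsumP[x + [y + ->]].
  rewrite !inE => /andP[xA xB] /orP[yA|yB]; last exact: mem_fsum.
  by rewrite addrC mem_fsum.
have leIU := fsubset_leq_card sIU.
have [ltn|gen] := ltnP #|` (A `&` B') <+> (A `|` B')| n.
  apply: convergent_bound.
    by move=> X Y X0 Y0 lt; apply: strong => //; apply: leq_trans lt leAB'.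
  have [K [sK pK leK]] := strong _ _ I0 U0 ltn.
  exists ((A `&` B') <+> (A `|` B')), K; split => //; first exact: fsum_neq0.
  by have := fsubset_leq_card (sub_fsum (A `&` B') sK); card_lia.
have eqIU : (A `&` B') <+> (A `|` B') = A <+> B'.
  by apply/eqP; rewrite eqEfcard sIU; apply: leq_trans leAB' gen.
have ltI : (#|` A `&` B'| < #|` A|)%N.
  apply: fproper_ltn_card; rewrite fproperEneq fsubsetIl andbT.
  by apply: contra nsub => /eqP <-; exact: fsubsetIr.
have [H [sH pH leH]] :=
  IHm _ _ (leq_trans leIU leAB') I0 U0 (leq_trans ltI leAm).
rewrite eqIU in pH leH; exists H; split => //.
by have := cardfsUI A B'; card_lia.
Qed.

(** * Periodic sets *)

Lemma exists_distinct (T : choiceType) (X : {fset T}) :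
  (1 < #|` X|)%N -> exists x y, [/\ x \in X, y \in X & x != y].
Proof.
move=> X2; have /fset0Pn[x xX] : X != fset0.
  by rewrite -cardfs_gt0; exact: ltnW.
have /fset0Pn[y] : X `\ x != fset0.
  by rewrite -cardfs_gt0; move: X2; rewrite (cardfsD1 x X) xX.
by rewrite !inE => /andP[yx yX]; exists y, x.
Qed.

Lemma periodic_set0 (G : zmodType) (x : G) : x != 0 -> periodic (@set0 G).
Proof.
move=> x0; have clT : zmod_closed (fun _ : G => true) by split.
pose N : zmodClosed G := HB.pack (fun _ : G => true)
  (GRing.isZmodClosed.Build G (fun=> true) clT).
exists N; split; first by exists x.
by rewrite /sumset -subset0 => z [].
Qed.

Lemma periodic_subgroup (G : zmodType) (K : {fset G}) (X : set G) :
  subgroup K -> (1 < #|` K|)%N ->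
  (forall x k, X x -> k \in K -> X (x + k)) -> periodic X.
Proof.
move=> sK K2 XK.
pose N : zmodClosed G := HB.pack (fun x : G => x \in K)
  (GRing.isZmodClosed.Build G (fun x => x \in K) sK).
exists N; split.
  have [x [y [xK yK xy]]] := exists_distinct K2.
  by exists (x - y); rewrite ?subr_eq0 //; exact: subgroupB.
apply/seteqP; split => [_ [x Xx [k kN <-]]|x Xx]; first exact: XK.
by exists x => //; exists 0; [exact: subgroup0 | rewrite addr0].
Qed.

Lemma sumset_fsum (G : zmodType) (A B : {fset G}) :
  sumset [set` A] [set` B] = [set` A <+> B].
Proof.
apply/seteqP; split => [_ [x xA [y yB <-]]|z /fsumP[x xA [y yB ->]]].
  exact: mem_fsum.
by exists x => //; exists y.
Qed.

Theorem theorem1 (G : zmodType) (A B : set G)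
    (finA : finite_set A) (finB : finite_set B)
    (cardAB : (#|` fset_set (sumset A B)| + 2
               <= #|` fset_set A| + #|` fset_set B|)%N) :
  periodic (sumset A B).
Proof.
move: cardAB; rewrite -(fset_setK finA) -(fset_setK finB).
move: (fset_set A) (fset_set B) => {finA finB} {}A {}B.
rewrite sumset_fsum !set_fsetK => leAB.
have [A0|A0] := eqVneq A fset0; last have [B0|B0] := eqVneq B fset0.
- have /exists_distinct[x [y [_ _ xy]]] : (1 < #|` B|)%N.
    by move: leAB; rewrite A0 cardfs0; card_lia.
  rewrite A0 (_ : [set` _] = set0); last first.
    by rewrite -subset0 => z /fsumP[].
  by apply: (@periodic_set0 _ (x - y)); rewrite subr_eq0.
- have /exists_distinct[x [y [_ _ xy]]] : (1 < #|` A|)%N.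
    by move: leAB; rewrite B0 cardfs0; card_lia.
  rewrite B0 (_ : [set` _] = set0); last first.
    by rewrite -subset0 => z /fsumP[? _ []].
  by apply: (@periodic_set0 _ (x - y)); rewrite subr_eq0.
have [H [sH pH leH]] := kneser A0 B0.
apply: (periodic_subgroup sH); first by card_lia.
by move=> x k /= xAB kH; rewrite -pH mem_fsum.
Qed.
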